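(* Suppose that $H=C\ast D$ is a free product, where the factors $C$ and $D$ are finitely generated groups with infinite abelianizations. Then for every proper word $w$ the set $w[H]$ is not rational in $H$.
   Context: A word is an element $w=w(x_1,\dots,x_n)$ of the free group $F(X)$ with basis $X=\{x_1,x_2,\dots\}$. For a group $G$, $w[G]=\{w(g_1,\dots,g_n) : g_1,\dots,g_n\in G\}$. The word $w$ is proper if there exist groups $G$ and $H$ such that $w[G]\neq \{1\}$ and $w[H]\neq H$. For a monoid $M$, the family $\mathrm{Rat}(M)$ of rational subsets of $M$ is the smallest family of subsets of $M$ that contains all finite subsets and is closed under union, product $L_1L_2=\{ab : a\in L_1, b\in L_2\}$, and submonoid generation $L\mapsto L^{\ast}$. A subset of a group $G$ is rational in $G$ if it belongs to $\mathrm{Rat}(G)$. The abelianization of a group $C$ is $C/[C,C]$. *)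

(* Defs.v *)
From mathcomp Require Import all_boot.
From mathcomp Require Import boolp classical_sets cardinality.

Set Implicit Arguments.
Unset Strict Implicit.
Unset Printing Implicit Defensive.

Local Open Scope classical_set_scope.
Local Open Scope group_scope.

(* The letter (i, true) stands for the i-th generator of the free group on
   countably many generators, and (i, false) for its inverse. *)
Definition letter := (nat * bool)%type.

Definition cancelling (a b : letter) : bool := (a.1 == b.1) && (a.2 != b.2).

(* The elements of the free group are identified with the reduced words. *)
Record word := Word {
  letters :> seq letter;
  letters_reduced : sorted (fun a b => ~~ cancelling a b) letters
}.

(* w(g_0, g_1, ...); only the g_i whose index occurs in w are relevant. *)
Definition eval_word (G : groupType) (w : word) (g : nat -> G) : G :=
  \prod_(a <- w) (if a.2 then g a.1 else (g a.1)^-1).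

Definition verbal_set (w : word) (G : groupType) : set G :=
  range (eval_word w (G := G)).
Arguments verbal_set w G : clear implicits.

Definition proper_word (w : word) : Prop :=
  (exists G : groupType, verbal_set w G <> [set 1]) /\
  (exists H : groupType, verbal_set w H <> [set: H]).

Definition setmulg (M : monoidType) (A B : set M) : set M :=
  [set a * b | a in A & b in B].

Definition submonoid (M : monoidType) (S : set M) : Prop :=
  S 1 /\ forall x y, S x -> S y -> S (x * y).

Definition generated_submonoid (M : monoidType) (A : set M) : set M :=
  smallest (@submonoid M) A.

Definition rational_closed (M : monoidType) (F : set (set M)) : Prop :=
  [/\ forall A B, F A -> F B -> F (A `|` B),
      forall A B, F A -> F B -> F (setmulg A B) &
      forall A, F A -> F (generated_submonoid A)].

Definition Rat (M : monoidType) : set (set M) :=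
  smallest (@rational_closed M) (@finite_set M).
Arguments Rat M : clear implicits.

Definition subgroup (G : groupType) (S : set G) : Prop :=
  [/\ S 1, forall x y, S x -> S y -> S (x * y) & forall x, S x -> S x^-1].

Definition generated_subgroup (G : groupType) (A : set G) : set G :=
  smallest (@subgroup G) A.

Definition finitely_generated (G : groupType) : Prop :=
  exists2 A : set G, finite_set A & generated_subgroup A = [set: G].

Definition derived_subgroup (G : groupType) : set G :=
  generated_subgroup [set [~ x, y] | x in [set: G] & y in [set: G]].
Arguments derived_subgroup G : clear implicits.

(* The underlying set of G / [G, G], as a set of cosets. *)
Definition abelianization (G : groupType) : set (set G) :=
  [set setmulg [set x] (derived_subgroup G) | x in [set: G]].
Arguments abelianization G : clear implicits.

(* H, with the maps iC and iD, is the free product (the coproduct in the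
   category of groups) of C and D. *)
Definition is_free_product (C D H : groupType)
    (iC : {multiplicative C -> H}) (iD : {multiplicative D -> H}) : Prop :=
  forall (K : groupType)
      (f : {multiplicative C -> K}) (g : {multiplicative D -> K}),
    exists h : {multiplicative H -> K},
      [/\ h \o iC =1 f, h \o iD =1 g &
          forall h' : {multiplicative H -> K},
            h' \o iC =1 f -> h' \o iD =1 g -> h' =1 h].

(* Main.v *)
Require Import Defs.
From mathcomp Require Import all_boot ssralg ssrnum ssrint intdiv.
From mathcomp Require Import generic_quotient.
From mathcomp Require Import boolp classical_sets cardinality.
From HB Require Import structures.
From mathcomp Require Import zify ring.

(** A finitely generated group with infinite abelianization maps onto the
    integers ([infinite_abelianization_character]), so [H] maps onto a free
    group of rank two, with basis [a], [b], inside the free group of reduced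
    words.  The image of a verbal set lies in the verbal set of the target, and
    the image of a rational set consists of the values of a regular language of
    possibly unreduced words ([rational_regular]).  It remains to contradict
    regularity in the free group, by playing a counting invariant against
    pumping.

    The invariant is Rhemtulla's.  For each [j], let [balance u j] be the number
    of factors [a b^j a] of the reduced word [u] minus the number of such
    factors of its inverse.  Each of these functions is a quasimorphism, and
    they are so simultaneously: the three junctions met when two reduced words
    are multiplied affect at most six values of [j] altogether
    ([balance_mul]).  Hence off a set of [j] whose size depends on [w] only,
    [balance (w(g)) j] is the combination of the [balance (g i) j] with the
    exponent sums of [w] as coefficients ([balance_eval]).  As [w] is proper,
    these exponent sums have a common divisor [k > 1]
    ([proper_word_modulus]); therefore [k] divides [balance (w(g)) j] for all
    but boundedly many [j].

    On the other side, substitute [b^i h b^-i] for the [i]-th variable of [w],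
    where [h] or its inverse is [(a b^N)^r a].  Nothing cancels inside the
    copies of [h], so the value has a reduced form that contains
    [(a b^N)^r a] ([reduce_substitute]).  The Cayley graph of a free group is a
    tree, so every spelling of this value passes through all the prefixes of the
    reduced form ([reduce_split]).  If [N] is the number of left quotients
    of the language, a quotient repeats within each block [b^N], and pumping
    turns the [r] exponents [N] into [r] distinct values, outside any
    prescribed finite set ([pump_blocks]).  The result still belongs to the
    image of the verbal set, but its balance is [1] at [r] values of [j]
    ([balance_blocks]), and [r] exceeds the bound above. *)

Set Implicit Arguments.
Unset Strict Implicit.
Unset Printing Implicit Defensive.

Local Open Scope classical_set_scope.

(** * Powers, homomorphisms and exponent sums *)

Definition zpow (G : groupType) (x : G) (k : int) : G :=
  match k with Posz n => (x ^+ n)%g | Negz n => (x ^- n.+1)%g end.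

Lemma zpowB (G : groupType) (x : G) (m n : nat) :
  zpow x (Posz m - Posz n)%R = (x ^+ m / x ^+ n)%g.
Proof.
case: (leqP n m) => nm.
  by rewrite subzn //= -expgnFr.
have -> : (Posz m - Posz n)%R = Negz (n - m).-1 by lia.
rewrite /= prednK ?subn_gt0 // expgnFr ?(ltnW nm) // invgF //.
Qed.

Lemma zpowD (G : groupType) (x : G) k l :
  zpow x (k + l)%R = (zpow x k * zpow x l)%g.
Proof.
have nat_diff (j : int) : exists m n : nat, j = (Posz m - Posz n)%R.
  by case: j => n; [exists n, 0 | exists 0, n.+1]; lia.
have [a [b ->]] := nat_diff k; have [c [d ->]] := nat_diff l.
have -> : (Posz a - Posz b + (Posz c - Posz d))%R =
  (Posz (a + c) - Posz (d + b))%R.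
  by lia.
rewrite !zpowB !expgnDr invgM !mulgA.
congr (_ * _)%g; rewrite -!mulgA; congr (_ * _)%g.
have cc : commute (x ^+ c) (x ^+ b)^-1.
  by apply/commuteV/commuteX2.
exact: cc.
Qed.

Lemma hom_of_character (C G : groupType) (chi : C -> int) (x : G) :
    {morph chi : y z / (y * z)%g >-> (y + z)%R} ->
  exists f : {multiplicative C -> G}, forall y, f y = zpow x (chi y).
Proof.
move=> chiM; pose f y := zpow x (chi y).
have fM : {morph f : y z / (y * z)%g} by move=> y z; rewrite /f chiM zpowD.
pose mf := isMultiplicative.Build C G f fM.
pose F : {multiplicative C -> G} := HB.pack f mf.
by exists F.
Qed.

Lemma hom1 (G K : groupType) (f : {multiplicative G -> K}) : f 1%g = 1%g.
Proof. by apply: (mulgI (f 1%g)); rewrite -gmulfM !mulg1. Qed.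

Lemma homV (G K : groupType) (f : {multiplicative G -> K}) x :
  f x^-1%g = (f x)^-1%g.
Proof. by apply: (mulgI (f x)); rewrite -gmulfM !mulgV hom1. Qed.

Lemma hom_eval_word (G K : groupType) (f : {multiplicative G -> K}) (w : word)
    (g : nat -> G) : f (eval_word w g) = eval_word w (f \o g).
Proof.
rewrite /eval_word (big_morph f (@gmulfM _ _ f) (hom1 f)).
by apply: eq_bigr => x _ /=; case: ifP => // _; rewrite homV.
Qed.

(** The value of [w] in the additive group of integers; the sums of exponents
    of the several variables are its coefficients. *)
Definition exponent_form (w : word) (c : nat -> int) : int :=
  (\sum_(x <- w) (if x.2 then c x.1 else - c x.1))%R.

Lemma eval_word_zpow (G : groupType) (x : G) (w : word) (c : nat -> int) :
  eval_word w (fun i => zpow x (c i)) = zpow x (exponent_form w c).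
Proof.
have zpowN k : zpow x (- k)%R = (zpow x k)^-1%g.
  by apply: (mulgI (zpow x k)); rewrite -zpowD GRing.subrr mulgV.
rewrite /eval_word /exponent_form; elim: (letters w) => [|y s IH].
  by rewrite !big_nil.
by rewrite !big_cons IH zpowD; case: ifP; rewrite ?zpowN.
Qed.

Definition zmod_closed_set (A : zmodType) (B : set A) : Prop :=
  B 0%R /\ forall x y, B x -> B y -> B (x - y)%R.

Lemma zmod_closed_mulz (A : zmodType) (B : set A) x (k : int) :
  zmod_closed_set B -> B x -> B (x *~ k)%R.
Proof.
move=> [B0 BB] Bx.
have BN y : B y -> B (- y)%R by move=> By; rewrite -GRing.sub0r; apply: (BB).
have Bn n : B (x *+ n)%R.
  elim: n => // n IH; rewrite GRing.mulrSr -[x in (_ + x)%R]GRing.opprK.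
  by apply: (BB) => //; apply: (BN).
by case: k => n /=; [apply: Bn | apply: (BN); apply: Bn].
Qed.

Lemma int_subgroup_principal (I : set int) : zmod_closed_set I ->
  exists d : nat, forall m, I m <-> (d %| m)%Z.
Proof.
move=> cI; have [I0 IB] := cI.
have Imul x k : I x -> I (k * x)%R.
  by move=> /(zmod_closed_mulz k cI); rewrite mulrzz GRing.mulrC.
have [[n0 n0P]|none] := pselect (exists n : nat, `[< I (Posz n.+1) >]); last first.
  exists 0 => m; rewrite dvd0z; split=> [Im|/eqP -> //].
  apply: contraT => m0; case: none; exists (absz m).-1.
  apply/asboolP; rewrite prednK ?absz_gt0 //.
  have -> : Posz (absz m) = (Num.sg m * m)%R by rewrite abszE Num.Theory.normrEsg.
  exact: Imul.
have exn : exists n : nat, `[< I (Posz n.+1) >] by exists n0.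
case: (ex_minnP exn) => n /asboolP In nmin; exists n.+1 => m.
split; last first.
  by move=> /dvdzP[k ->]; apply: Imul.
move=> Im; have Ir : I (m %% n.+1)%Z.
  by rewrite /modz; apply: (IB) => //; apply: Imul.
apply/dvdz_mod0P.
case r : (m %% n.+1)%Z Ir => [[|k]|k] // Ik.
  have := nmin k; rewrite asboolT // => /(_ isT) nk.
  by have := @ltz_pmod m n.+1 isT; rewrite r; lia.
by have := @modz_ge0 m n.+1 isT; rewrite r.
Qed.

Lemma proper_word_neq0 (w : word) : proper_word w -> letters w != [::].
Proof.
move=> [[G nG] _]; apply/eqP => w0; apply: nG; apply/seteqP.
rewrite /verbal_set /eval_word w0; split=> [_ [g _ <-]|_ ->].
  by rewrite big_nil.
by exists (fun=> 1%g); rewrite ?big_nil.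
Qed.

(** The values of [w] in the integers form a subgroup [dZ].  If [d = 1], then by
    Bezout some substitution of powers of [x] in [w] gives [x] itself, in every
    group, against properness.  If [d = 0], all exponent sums vanish and any
    [k > 1] serves. *)
Lemma proper_word_modulus (w : word) : proper_word w ->
  exists2 k : nat, 1 < k & forall c, (k %| exponent_form w c)%Z.
Proof.
move=> [_ [G nG]].
have [|d dP] := @int_subgroup_principal (range (exponent_form w)).
  split; first by exists (fun=> 0%R); rewrite // /exponent_form big1 // => x _;
    case: ifP.
  move=> _ _ [c _ <-] [c' _ <-]; exists (fun i => c i - c' i)%R => //.
  rewrite /exponent_form -GRing.sumrB; apply: eq_bigr => x _.
  by case: ifP => _; rewrite // GRing.opprB GRing.opprK GRing.addrC.
have dw c : (d %| exponent_form w c)%Z by apply/dP; exists c.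
case: d dP dw => [|[|d]] dP dw; last by exists d.+2.
  by exists 2 => // c; have := dw c; rewrite dvd0z => /eqP ->.
case: nG; apply/seteqP; split=> // x _.
have /dP[c _ c1] : (1%N %| 1)%Z by [].
by exists (fun i => zpow x (c i)); rewrite // eval_word_zpow c1.
Qed.

(** * Characters of groups with infinite abelianization *)

(** The generators are adjoined to [B] one at a time.  Let [x] be the last of
    them that has no positive multiple in the subgroup [B'] reached so far, if
    there is one.  All later generators have finite order modulo the subgroup
    that [B'] and [x] generate, so some [M > 0] brings every [a] into it, and
    the coefficient of [x] in [a *+ M] is well defined and additive in [a]. *)
Lemma torsion_or_character (A : zmodType) (s : seq A) (B : set A) :
    zmod_closed_set B ->
    (forall B' : set A, zmod_closed_set B' -> B `<=` B' ->
      (forall x, x \in s -> B' x) -> forall a, B' a) ->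
  (exists2 M, 0 < M & forall a, B (a *+ M)%R) \/
  (exists chi : A -> int,
    {morph chi : x y / (x + y)%R} /\ exists a, chi a <> 0%R).
Proof.
elim: s B => [|x s IH] B cB gen.
  left; exists 1%N => // a; rewrite GRing.mulr1n; exact: (gen B).
have [B0 BB] := cB.
have BD u v : B u -> B v -> B (u + v)%R.
  move=> Bu Bv; rewrite -[v]GRing.opprK; apply: (BB) => //.
  by rewrite -GRing.sub0r; apply: (BB).
pose B1 : set A := [set a | exists k : int, B (a - x *~ k)%R].
have cB1 : zmod_closed_set B1.
  split; first by exists 0%R; rewrite mulr0z GRing.subr0.
  move=> u v [k Bk] [l Bl]; exists (k - l)%R.
  have -> : (u - v - x *~ (k - l) = (u - x *~ k) - (v - x *~ l))%R.
    rewrite mulrzBr !GRing.opprB GRing.addrACA [RHS]GRing.addrACA.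
    by rewrite [(- v + _)%R]GRing.addrC -!GRing.addrA; congr (_ + _)%R;
       rewrite GRing.addrC.
  exact: (BB).
have [B' cB' B1B' sB'|[M M0 tM]|ch] := IH B1 cB1; last by right.
  apply: gen => //.
    by move=> u Bu; apply: B1B'; exists 0%R; rewrite mulr0z GRing.subr0.
  move=> u; rewrite inE => /predU1P[->|/sB' //].
  by apply: B1B'; exists 1%R; rewrite mulr1z GRing.subrr.
have [[m m0 Bm]|tor] := pselect (exists2 m, 0 < m & B (x *+ m)%R).
  left; exists (M * m); first by rewrite muln_gt0 M0.
  move=> a; have [k Bk] := tM a.
  have -> : (a *+ (M * m) = (a *+ M - x *~ k) *~ Posz m + x *~ Posz m *~ k)%R.
    by rewrite mulrzBl [(x *~ _ *~ k)%R]mulrzAC GRing.subrK GRing.mulrnA.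
  by apply: BD; apply: zmod_closed_mulz.
right; have /choice[chi chiP] := tM.
have uniq_chi k l u : B (u - x *~ k)%R -> B (u - x *~ l)%R -> k = l.
  move=> Bk Bl; have h : B (x *~ (l - k))%R.
    have -> : (x *~ (l - k) = (u - x *~ k) - (u - x *~ l))%R.
      by rewrite mulrzBr GRing.opprB [RHS]GRing.addrC GRing.addrA GRing.subrK.
    exact: (BB).
  apply: contrapT => kl; apply: tor; exists (absz (l - k)%R).
    by rewrite absz_gt0 GRing.subr_eq0; apply/eqP => e; apply: kl.
  have -> : (x *+ absz (l - k) = (x *~ (l - k)) *~ Num.sg (l - k))%R.
    by rewrite -mulrzA GRing.mulrC -Num.Theory.normrEsg -abszE.
  exact: zmod_closed_mulz.
exists chi; split.
  move=> u v; apply: (uniq_chi _ _ ((u + v) *+ M)%R) => //.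
  have -> : ((u + v) *+ M - x *~ (chi u + chi v) =
             (u *+ M - x *~ chi u) + (v *+ M - x *~ chi v))%R.
    by rewrite GRing.mulrnDl mulrzDr GRing.opprD GRing.addrACA.
  exact: BD.
exists x => chi0; have := chiP x; rewrite chi0 mulr0z GRing.subr0 => h.
by apply: tor; exists M.
Qed.

Fixpoint bounded_span (A : zmodType) (M : nat) (s : seq A) : set A :=
  if s is x :: s' then
    [set (x *+ k.1 + k.2)%R | k in `I_M `*` bounded_span M s']
  else [set 0%R].

(** Coefficients of the generators only matter modulo the exponent [M], so the
    combinations with coefficients below [M] exhaust the group. *)
Lemma finite_exponent_finite (A : zmodType) (s : seq A) (M : nat) : 0 < M ->
    (forall a : A, a *+ M = 0)%R ->
    (forall B : set A, zmod_closed_set B ->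
      (forall x, x \in s -> B x) -> forall a, B a) ->
  finite_set [set: A].
Proof.
move=> M0 tM gen.
have fin t : finite_set (@bounded_span A M t).
  elim: t => [|x t IH]; first exact: finite_set1.
  by apply: finite_image; apply: finite_setX => //; apply: finite_II.
have sp0 t : @bounded_span A M t 0%R.
  elim: t => // x t IH; exists (0, 0%R) => //=.
  by rewrite GRing.mulr0n GRing.addr0.
have modM (x : A) k : (x *+ (k %% M) = x *+ k)%R.
  by rewrite [in RHS](divn_eq k M) GRing.mulrnDr mulnC GRing.mulrnA tM
    GRing.mul0rn GRing.add0r.
have spD t u v : @bounded_span A M t u -> @bounded_span A M t v ->
    @bounded_span A M t (u + v)%R.
  elim: t u v => [|x t IH] u v /=; first by move=> -> ->; rewrite /= GRing.addr0.
  move=> [[k a] /= [kM ta] <-] [[l b] /= [lM tb] <-].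
  exists ((k + l) %% M, a + b)%R => /=; first by split; [apply: ltn_pmod | apply: IH].
  by rewrite modM GRing.mulrnDr GRing.addrACA.
have spn t u n : @bounded_span A M t u -> @bounded_span A M t (u *+ n)%R.
  move=> tu; elim: n => [|n IH]; first exact: sp0.
  by rewrite GRing.mulrS; apply: spD.
apply: sub_finite_set (fin s) => a _; apply: (gen (bounded_span M s)); last first.
  elim: (s) => // x t IH y; rewrite inE => /predU1P[->|/IH ty].
    exists (1 %% M, 0%R); first by split; [apply: ltn_pmod | apply: sp0].
    by rewrite /= modM GRing.addr0.
  by exists (0, y) => //=; rewrite GRing.mulr0n GRing.add0r.
split=> // u v tu tv; have -> : (- v = v *+ M.-1)%R.
  by apply/eqP; rewrite eq_sym -GRing.subr_eq0 GRing.opprK -GRing.mulrSr prednK // tM.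
by apply: spD => //; apply: spn.
Qed.

Lemma derived1 (C : groupType) : derived_subgroup C 1%g.
Proof. by move=> S [[]]. Qed.

Lemma derivedM (C : groupType) x y :
  derived_subgroup C x -> derived_subgroup C y -> derived_subgroup C (x * y)%g.
Proof.
by move=> dx dy S [cS RS]; have [_ SM _] := cS; apply: SM; [apply: dx|apply: dy].
Qed.

Lemma derivedV (C : groupType) x :
  derived_subgroup C x -> derived_subgroup C x^-1%g.
Proof. by move=> dx S [cS RS]; have [_ _ SV] := cS; apply: SV; apply: dx. Qed.

Lemma derivedR (C : groupType) (x y : C) : derived_subgroup C [~ x, y]%g.
Proof. by move=> S [_ RS]; apply: RS; exists x => //; exists y. Qed.

Lemma derivedJ (C : groupType) (x y : C) :
  derived_subgroup C x -> derived_subgroup C (x ^ y)%g.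
Proof.
move=> dx; rewrite -[(x ^ y)%g](mulVKg x) -commgEl.
exact: derivedM (derivedR _ _).
Qed.

Definition abel_rel (C : groupType) : rel C :=
  fun x y => `[< derived_subgroup C (x^-1 * y)%g >].

Lemma abel_relP (C : groupType) : equiv_class_of (@abel_rel C).
Proof.
split=> [x|x y|y x z]; rewrite /abel_rel.
- by apply/asboolP; rewrite mulVg; apply: derived1.
- by apply: asbool_equiv_eq; split=> /derivedV; rewrite invgM invgK.
move=> /asboolP xy /asboolP yz; apply/asboolP.
by rewrite -[z](mulVKg y) mulgA; apply: derivedM.
Qed.

Canonical abel_equiv (C : groupType) := EquivRelPack (abel_relP C).

(** The abelianization with the structure of a Z-module, so that multiples and
    integer combinations are available. *)
Definition abel (C : groupType) : Type := {eq_quot (abel_equiv C)}%qT.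

HB.instance Definition _ (C : groupType) := Choice.on (abel C).

Definition abel_pi (C : groupType) (x : C) : abel C :=
  \pi_({eq_quot (abel_equiv C)}%qT)%qT x.
Definition abel_repr (C : groupType) (a : abel C) : C :=
  repr (a : {eq_quot (abel_equiv C)}%qT).

Lemma abel_piP (C : groupType) (x y : C) :
  abel_pi x = abel_pi y <-> derived_subgroup C (x^-1 * y)%g.
Proof.
split=> [/eqP|d]; first by rewrite /abel_pi eqmodE => /asboolP.
by apply/eqP; rewrite /abel_pi eqmodE; apply/asboolP.
Qed.

Lemma abel_reprK (C : groupType) : cancel (@abel_repr C) (@abel_pi C).
Proof. by move=> a; rewrite /abel_pi /abel_repr reprK. Qed.

Definition abel_add (C : groupType) (a b : abel C) : abel C :=
  abel_pi (abel_repr a * abel_repr b)%g.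
Definition abel_opp (C : groupType) (a : abel C) : abel C :=
  abel_pi (abel_repr a)^-1%g.

Lemma abel_piM (C : groupType) (x y : C) :
  abel_pi (x * y)%g = abel_add (abel_pi x) (abel_pi y).
Proof.
apply/abel_piP.
have /abel_piP dx := esym (abel_reprK (abel_pi x)).
have /abel_piP dy := esym (abel_reprK (abel_pi y)).
set x' := abel_repr _ in dx *; set y' := abel_repr _ in dy *.
have -> : ((x * y)^-1 * (x' * y') = (x^-1 * x') ^ y * (y^-1 * y'))%g.
  by rewrite conjgE invgM !mulgA mulgK.
by apply: derivedM => //; apply: derivedJ.
Qed.

Lemma abel_piV (C : groupType) (x : C) : abel_pi x^-1%g = abel_opp (abel_pi x).
Proof.
apply/abel_piP; rewrite invgK.
have /abel_piP/derivedV/(derivedJ (x^-1)%g) dx := esym (abel_reprK (abel_pi x)).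
by move: dx; rewrite conjgE !invgM !invgK mulgK.
Qed.

Lemma abel_addA (C : groupType) : associative (@abel_add C).
Proof.
move=> a b c; rewrite -[a]abel_reprK -[b]abel_reprK -[c]abel_reprK.
by rewrite -!abel_piM mulgA.
Qed.

Lemma abel_addC (C : groupType) : commutative (@abel_add C).
Proof.
move=> a b; rewrite -[a]abel_reprK -[b]abel_reprK -!abel_piM.
apply/abel_piP; rewrite invgM -mulgA -conjgE -commgEl; exact: derivedR.
Qed.

Lemma abel_add0 (C : groupType) : left_id (abel_pi 1%g) (@abel_add C).
Proof. by move=> a; rewrite -[a]abel_reprK -abel_piM mul1g. Qed.

Lemma abel_addN (C : groupType) :
  left_inverse (abel_pi 1%g) (@abel_opp C) (@abel_add C).
Proof. by move=> a; rewrite -[a]abel_reprK -abel_piV -abel_piM mulVg. Qed.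

HB.instance Definition _ (C : groupType) :=
  GRing.isZmodule.Build (abel C) (@abel_addA C) (@abel_addC C) (@abel_add0 C)
    (@abel_addN C).

Lemma abel_piD (C : groupType) (x y : C) :
  abel_pi (x * y)%g = (abel_pi x + abel_pi y)%R.
Proof. exact: abel_piM. Qed.

Lemma abel_piN (C : groupType) (x : C) : abel_pi x^-1%g = (- abel_pi x)%R.
Proof. exact: abel_piV. Qed.

(** If the abelianization had no nonzero character, it would have finite exponent
    by [torsion_or_character] and would then be finite.  A nonzero character is
    divided by the generator of its image, to become surjective. *)
Lemma infinite_abelianization_character (C : groupType) :
    finitely_generated C -> infinite_set (abelianization C) ->
  exists2 chi : C -> int, {morph chi : x y / (x * y)%g >-> (x + y)%R} &
    exists c, chi c = 1%R.
Proof.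
move=> [S0 /finite_seqP[s ->] genC] infC.
have gen (B : set (abel C)) : zmod_closed_set B ->
    (forall a, a \in map (@abel_pi C) s -> B a) -> forall a, B a.
  move=> [B0 BB] sB a; rewrite -[a]abel_reprK.
  have : [set: C] (abel_repr a) by []; rewrite -genC.
  apply: (_ : (generated_subgroup [set` s] `<=` [set x | B (abel_pi x)])).
  apply: smallest_sub => [|x xs /=]; last by apply: sB; apply: map_f.
  have BN x : B x -> B (- x)%R by move=> Bx; rewrite -GRing.sub0r; apply: (BB).
  split=> //= [x y Bx By|x Bx]; last by rewrite abel_piN; apply: (BN).
  rewrite abel_piD -[abel_pi y]GRing.opprK.
  by apply: (BB) => //; apply: (BN).
have c0 : zmod_closed_set ([set 0%R] : set (abel C)).
  by split=> // x y -> ->; rewrite /= GRing.subr0.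
have [B cB _ sB||] := @torsion_or_character _ (map (@abel_pi C) s) _ c0.
- exact: gen.
- move=> [M M0 tM]; case: infC.
  have /(finite_image (fun a => setmulg [set abel_repr a] (derived_subgroup C))) fin :=
    finite_exponent_finite M0 tM gen.
  apply: sub_finite_set fin => _ [x _ <-]; exists (abel_pi x) => //.
  have /abel_piP dx := abel_reprK (abel_pi x).
  set x' := abel_repr _ in dx *.
  apply/seteqP; split=> _ [_ -> [d Dd <-]].
    exists x => //; exists (x^-1 * x' * d)%g; last by rewrite !mulgA mulgV mul1g.
    apply: derivedM => //; rewrite -[x']invgK -invgM; exact: derivedV.
  exists x' => //; exists (x'^-1 * x * d)%g; last by rewrite !mulgA mulgV mul1g.
  exact: derivedM.
move=> [chi [chiD [a chia]]].
have chi0 : chi 0%R = 0%R by have := chiD 0%R 0%R; rewrite GRing.addr0; lia.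
have chiB u v : chi (u - v)%R = (chi u - chi v)%R.
  by have := chiD (u - v)%R v; rewrite GRing.subrK => ->; rewrite GRing.addrK.
have [|d dP] := @int_subgroup_principal (range chi).
  split; first by exists 0%R.
  by move=> _ _ [u _ <-] [v _ <-]; exists (u - v)%R.
have d0 : d != 0.
  apply/eqP => d0; case: chia; have /dP : range chi (chi a) by exists a.
  by rewrite d0 dvd0z => /eqP.
have chid u : (d %| chi u)%Z by apply/dP; exists u.
exists (fun x => (chi (abel_pi x) %/ d)%Z).
  move=> x y; rewrite abel_piD chiD.
  by rewrite divzDl.
have /dP[u _ ud] : (d %| Posz d)%Z by [].
by exists (abel_repr u); rewrite abel_reprK ud divzz d0.
Qed.

(** * The free group of reduced words *)

Notation reduced := (sorted (fun x y : letter => ~~ cancelling x y)).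

Definition linv (c : letter) : letter := (c.1, ~~ c.2).

Definition winv (s : seq letter) : seq letter := rev (map linv s).

Definition push (c : letter) (s : seq letter) : seq letter :=
  if s is d :: s' then if cancelling c d then s' else c :: s else [:: c].

Definition reduce (s : seq letter) : seq letter := foldr push [::] s.

Lemma linvK : involutive linv.
Proof. by case=> i e; rewrite /linv /= negbK. Qed.

Lemma cancellingE c d : cancelling c d = (d == linv c).
Proof.
case: c d => [i e] [j f]; rewrite /cancelling /linv xpair_eqE /= eq_sym.
by case: e; case: f.
Qed.

Lemma winvK : involutive winv.
Proof. by move=> s; rewrite /winv map_rev revK mapK //; apply: linvK. Qed.

Lemma winv_cat x y : winv (x ++ y) = winv y ++ winv x.
Proof. by rewrite /winv map_cat rev_cat. Qed.

Lemma winv_reduced s : reduced s -> reduced (winv s).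
Proof.
rewrite /winv rev_sorted sorted_map; apply: sub_sorted => x y /=.
by rewrite !cancellingE linvK; apply: contra => /eqP ->.
Qed.

Lemma push_reduced c s : reduced s -> reduced (push c s).
Proof.
case: s => // d s /= ds; case: ifPn => [_|/= -> //].
by apply: path_sorted ds.
Qed.

Lemma foldr_push_reduced x z : reduced z -> reduced (foldr push z x).
Proof. by move=> zr; elim: x => //= c x; apply: push_reduced. Qed.

Lemma reduce_reduced s : reduced (reduce s).
Proof. exact: foldr_push_reduced. Qed.

Lemma reduce_id s : reduced s -> reduce s = s.
Proof.
elim: s => //= c s IH cs; rewrite IH ?(path_sorted cs) //.
by case: s cs {IH} => //= d s /andP[/negbTE -> _].
Qed.

Lemma push_linv c s : reduced s -> push (linv c) (push c s) = s.
Proof.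
case: s => [_ /=|d s /= ds]; first by rewrite cancellingE linvK eqxx.
rewrite cancellingE; case: eqP => [dE|_] /=; last first.
  by rewrite cancellingE linvK eqxx.
by case: s ds => [|e s] /=; rewrite -dE // => /andP[/negbTE ->].
Qed.

(** Pushing letters one by one is an action of the free group on reduced words,
    because [push (linv c)] undoes [push c]; hence it only depends on the
    reduced form of what is pushed.  Associativity of the product follows. *)
Lemma foldr_push_reduce x z :
  reduced z -> foldr push z (reduce x) = foldr push z x.
Proof.
move=> zr; elim: x => //= c x <-.
case: (reduce x) => //= d s; rewrite cancellingE; case: eqP => //= ->.
by have := @push_linv (linv c) (foldr push z s); rewrite linvK => -> //;
  apply: foldr_push_reduced.
Qed.

Lemma reduce_cat x y : reduce (x ++ y) = foldr push (reduce y) x.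
Proof. exact: foldr_cat. Qed.

Lemma reduce_catr x y : reduce (x ++ reduce y) = reduce (x ++ y).
Proof. by rewrite !reduce_cat reduce_id // reduce_reduced. Qed.

Lemma reduce_catl x y : reduce (reduce x ++ y) = reduce (x ++ y).
Proof. by rewrite !reduce_cat foldr_push_reduce // reduce_reduced. Qed.

Lemma reduce_winv s : reduce (winv s ++ s) = [::].
Proof.
elim: s => //= c s IH; rewrite /winv map_cons rev_cons -cats1 -catA /=.
by rewrite reduce_cat /= push_linv ?reduce_reduced // -reduce_cat.
Qed.

HB.instance Definition _ := [isSub for letters].
HB.instance Definition _ := [Choice of word by <:].

(** The reduced words, which serve as the words [w], also form the free group on
    countably many letters; the target of all homomorphisms below is this group,
    of which the first two letters generate a free subgroup of rank two. *)
Definition word_one : word := @Word [::] isT.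
Definition word_mul (u v : word) : word := Word (reduce_reduced (u ++ v)).
Definition word_inv (u : word) : word := Word (winv_reduced (letters_reduced u)).

Lemma word_mulA : associative word_mul.
Proof.
by move=> u v t; apply: val_inj; rewrite /= reduce_catl reduce_catr catA.
Qed.

Lemma word_mul1 : left_id word_one word_mul.
Proof. by move=> u; apply: val_inj; rewrite /= reduce_id // letters_reduced. Qed.

Lemma word_1mul : right_id word_one word_mul.
Proof.
by move=> u; apply: val_inj; rewrite /= cats0 reduce_id // letters_reduced.
Qed.

Lemma word_mulV : left_inverse word_one word_inv word_mul.
Proof. by move=> u; apply: val_inj; rewrite /= reduce_winv. Qed.

Lemma word_Vmul : right_inverse word_one word_inv word_mul.
Proof.
move=> u; apply: val_inj => /=.
by rewrite -{1}[letters u]winvK reduce_winv.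
Qed.

HB.instance Definition _ :=
  isGroup.Build word word_mulA word_mul1 word_1mul word_mulV word_Vmul.

Lemma positive_reduced (s : seq letter) : all snd s -> reduced s.
Proof.
elim: s => //= c [|d s] IH //= /andP[c2 ds2]; rewrite [path _ _ _]IH // andbT.
by case/andP: ds2 => d2 _; rewrite /cancelling c2 d2 andbF.
Qed.

Lemma foldr_push_positive s (c : letter) z : all snd s -> c.2 ->
  foldr push (c :: z) s = s ++ c :: z.
Proof.
move=> + c2; elim: s => //= d s IH /andP[d2 s2]; rewrite IH //.
by case: s s2 {IH} => [|d' s] /=; rewrite /cancelling d2 ?c2 ?andbF // => /andP[-> _];
  rewrite andbF.
Qed.

Lemma reduce_cat_positive x y s (c : letter) z : all snd s -> c.2 ->
  reduce x = s -> reduce y = c :: z -> reduce (x ++ y) = s ++ c :: z.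
Proof.
move=> spos c2 ex ey; rewrite reduce_cat -foldr_push_reduce ?reduce_reduced //.
by rewrite ex ey foldr_push_positive.
Qed.

Definition la : letter := (0, true).
Definition lb : letter := (1, true).

(** In the Cayley tree, a path from the origin to the vertex [p ++ q] runs
    through every vertex of the geodesic, in particular through [p]. *)
Lemma reduce_split s p q : reduce s = p ++ q ->
  exists s1 s2, [/\ s = s1 ++ s2, reduce s1 = p & reduce s2 = q].
Proof.
elim: s p => [|c s IH] [|d p] //= e; try by exists [::], s.
- by exists [::], [::].
- by exists [::], (c :: s).
case sE: (reduce s) e => [|c' s'] /=.
  move=> [<- e0]; have [s1 [s2 [-> e1 e2]]] := IH p (etrans sE e0).
  exists (c :: s1), s2; split=> //=; rewrite e1.
  by case: (p) e0.
case: ifP => [cc' s'E|ncc' [<- e0]].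
  (* the first step [c] is undone later: the rest of the path passes [c' :: d :: p] *)
  have [|s1 [s2 [-> e1 e2]]] := IH (c' :: d :: p); first by rewrite sE s'E.
  by exists (c :: s1), s2; split=> //=; rewrite e1 /= cc'.
have [s1 [s2 [-> e1 e2]]] := IH p (etrans sE e0).
exists (c :: s1), s2; split=> //=; rewrite e1.
by case: p e0 {e1} => //= x p [<- _]; rewrite ncc'.
Qed.

Lemma reduce_cat_cancel x y : reduced x -> reduced y ->
  exists p t q, [/\ x = p ++ t, y = winv t ++ q & reduce (x ++ y) = p ++ q].
Proof.
move=> xr yr; elim: x xr => [_|c x IH cx].
  by exists [::], [::], y; rewrite reduce_id.
have [p [t [q [xE yE e]]]] := IH (path_sorted cx).
case: p xE e => [|d p] xE e; last first.
  exists (c :: d :: p), t, q; rewrite xE yE; split=> //=.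
  move: e; rewrite xE yE => /= ->; rewrite /push.
  by move: cx; rewrite xE /= => /andP[/negbTE -> _].
case: q yE e => [|d q] yE e.
  by exists [:: c], t, [::]; rewrite /= e xE yE.
have [cd|/negbTE ncd] := boolP (cancelling c d); last first.
  by exists [:: c], t, (d :: q); rewrite /= e xE yE /= ncd.
exists [::], (c :: t), q; rewrite /= e /= cd xE yE; split=> //.
by rewrite /winv map_cons rev_cons -cats1 -catA /= -(eqP (_ : d == linv c)) -?cancellingE.
Qed.

Lemma hom_image_letters (G : groupType) (phi : {multiplicative G -> word})
    (g0 g1 : G) : letters (phi g0) = [:: la] -> letters (phi g1) = [:: lb] ->
  forall s, all (fun c : letter => c.1 < 2) s ->
    exists h, letters (phi h) = reduce s.
Proof.
move=> e0 e1; elim=> [|c s IH] /=; first by exists 1%g; rewrite hom1.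
case/andP=> c2 /IH[h eh].
suff [k ek] : exists k, letters (phi k) = [:: c].
  exists (k * h)%g; rewrite gmulfM -[LHS]/(reduce (phi k ++ phi h)) ek eh /=.
  by rewrite reduce_id // reduce_reduced.
case: c c2 => -[|[|//]] [] _;
  [by exists g0 | exists g0^-1%g | by exists g1 | exists g1^-1%g].
  by rewrite homV -[LHS]/(winv (phi g0)) e0.
by rewrite homV -[LHS]/(winv (phi g1)) e1.
Qed.

(** * The block-counting quasimorphisms *)

(** The list of the [j] for which [a b^j a] occurs, with repetitions, as produced
    by a scan from left to right.  The state is [Some i] when the letters read
    so far end in [a b^i], and [None] otherwise.  A scan with states makes the
    effect of concatenation transparent. *)
Fixpoint runs (st : option nat) (s : seq letter) : seq nat :=
  if s is c :: s' then
    if c == la then (if st is Some i then [:: i] else [::]) ++ runs (Some 0) s'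
    else runs (if c == lb then omap S st else None) s'
  else [::].

Fixpoint run_state (st : option nat) (s : seq letter) : option nat :=
  if s is c :: s' then
    run_state (if c == la then Some 0
               else if c == lb then omap S st else None) s'
  else st.

Lemma runs_cat st x y : runs st (x ++ y) = runs st x ++ runs (run_state st x) y.
Proof. by elim: x st => //= c x IH st; case: eqP => _; rewrite IH ?catA. Qed.

(** Counting the exceptions is essential: the bound must depend on the word [w]
    alone, while the exceptional arguments vary with the group elements. *)
Definition agree_off (n : nat) (f g : nat -> int) : Prop :=
  exists2 E : seq nat, size E <= n & forall j, j \notin E -> f j = g j.

Lemma agree_off_eq f g : f =1 g -> agree_off 0 f g.
Proof. by move=> fg; exists [::]. Qed.

Lemma agree_off_trans m n f g h :
  agree_off m f g -> agree_off n g h -> agree_off (m + n) f h.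
Proof.
move=> [E1 s1 e1] [E2 s2 e2]; exists (E1 ++ E2); first by rewrite size_cat leq_add.
by move=> j; rewrite mem_cat negb_or => /andP[/e1 -> /e2].
Qed.

Lemma agree_off_sym n f g : agree_off n f g -> agree_off n g f.
Proof. by move=> [E s e]; exists E => // j /e. Qed.

Lemma agree_off_add m n f1 f2 g1 g2 : agree_off m f1 g1 -> agree_off n f2 g2 ->
  agree_off (m + n) (fun j => f1 j + f2 j)%R (fun j => g1 j + g2 j)%R.
Proof.
move=> [E1 s1 e1] [E2 s2 e2]; exists (E1 ++ E2); first by rewrite size_cat leq_add.
by move=> j; rewrite mem_cat negb_or => /andP[/e1 -> /e2 ->].
Qed.

Definition nruns (s : seq letter) (j : nat) : int := Posz (count_mem j (runs None s)).

Definition balance (s : seq letter) (j : nat) : int :=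
  (nruns s j - nruns (winv s) j)%R.

(** Once a letter other than [b] has been read, scans from different states are
    in the same state, and by then their outputs differ by one number at most. *)
Lemma runs_sync st s :
  agree_off 1 (fun j => Posz (count_mem j (runs st s)))
              (fun j => Posz (count_mem j (runs None s))).
Proof.
case: st => [i|]; last by exists [::].
elim: s i => [|c s IH] i /=; first by exists [::].
case: eqP => _ /=; last by case: eqP => _; [apply: IH | exists [::]].
exists [:: i] => //= j; rewrite inE eq_sym => /negbTE ->.
by rewrite add0n.
Qed.

Lemma nruns_cat x y :
  agree_off 1 (nruns (x ++ y)) (fun j => nruns x j + nruns y j)%R.
Proof.
have [E sE e] := runs_sync (run_state None x) y.
by exists E => // j /e eq_j; rewrite /nruns runs_cat count_cat PoszD eq_j.
Qed.

Lemma balance_cat x y :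
  agree_off 2 (balance (x ++ y)) (fun j => balance x j + balance y j)%R.
Proof.
have [E1 s1 e1] := nruns_cat x y.
have [E2 s2 e2] := nruns_cat (winv y) (winv x).
exists (E1 ++ E2); first by rewrite size_cat (leq_add s1 s2).
move=> j; rewrite mem_cat negb_or => /andP[/e1 h1 /e2 h2].
rewrite /balance winv_cat h1 h2; ring.
Qed.

Lemma balance_winv s j : balance (winv s) j = (- balance s j)%R.
Proof. by rewrite /balance winvK GRing.opprB. Qed.

(** With [u = p t] and [v = t^-1 q], the balances of [t] and of its inverse
    cancel, and each of the three junctions in [p q], [p t] and [t^-1 q] costs
    two exceptions, one for each of the two counts. *)
Lemma balance_mul (u v : word) :
  agree_off 6 (balance (u * v)%g) (fun j => balance u j + balance v j)%R.
Proof.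
have [p [t [q [uE vE e]]]] :=
  reduce_cat_cancel (letters_reduced u) (letters_reduced v).
have -> : letters (u * v)%g = p ++ q by [].
rewrite uE vE -[6]/(2 + (0 + 4)); apply: (agree_off_trans (balance_cat p q)).
have h := agree_off_add (balance_cat p t) (balance_cat (winv t) q).
apply: agree_off_trans (agree_off_sym h).
by apply: agree_off_eq => j; rewrite balance_winv; ring.
Qed.

Lemma balance_eval (w : word) (g : nat -> word) :
  agree_off (6 * size w) (balance (eval_word w g))
            (fun j => exponent_form w (fun i => balance (g i) j)).
Proof.
rewrite /exponent_form /eval_word; elim: (letters w) => [|x s IH].
  by exists [::] => // j _; rewrite !big_nil.
rewrite big_cons /= mulnS; apply: (agree_off_trans (balance_mul _ _)).
have [E sE e] := IH; exists E => // j /e; rewrite big_cons => ->.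
by case: ifP => // _; rewrite -balance_winv.
Qed.

(** * Regular languages and images of rational sets *)

(** Regularity in the form of Myhill and Nerode: the left quotients of [L] are
    indexed by a finite type.  Closure under union, product and star then
    comes down to formulas for the left quotients. *)
Definition regular (T : eqType) (L : set (seq T)) : Prop :=
  exists (Q : finType) (f : Q -> set (seq T)),
    forall x, exists q, forall y, L (x ++ y) <-> f q y.

Definition lang_cat (T : eqType) (L1 L2 : set (seq T)) : set (seq T) :=
  [set x ++ y | x in L1 & y in L2].

Definition lang_star (T : eqType) (L : set (seq T)) : set (seq T) :=
  [set z | exists2 ws, z = flatten ws & forall u, u \in ws -> L u].

Lemma cat_eq_cat (T : Type) (x y u v : seq T) : x ++ y = u ++ v ->
  (exists z, x = u ++ z /\ v = z ++ y) \/ (exists z, u = x ++ z /\ y = z ++ v).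
Proof.
elim: x u => [|c x IH] u /=; first by move=> ->; right; exists u.
case: u => [|d u] /=; first by move=> <-; left; exists (c :: x).
move=> [-> /IH[[z [-> ->]]|[z [-> ->]]]]; [left|right]; by exists z.
Qed.

Lemma regular0 (T : eqType) : regular (set0 : set (seq T)).
Proof. by exists unit, (fun=> set0) => x; exists tt. Qed.

Lemma regular1 (T : eqType) (s : seq T) : regular [set s].
Proof.
exists (option 'I_(size s).+1),
  (fun o : option 'I__ => if o is Some i then [set drop i s] else set0) => x.
have [xs|xs] := eqVneq (take (size x) s) x; last first.
  exists None => y /=; split=> // e; case/eqP: xs.
  by rewrite -e take_size_cat.
have lx : size x < (size s).+1 by rewrite -xs size_take_min ltnS geq_minr.
exists (Some (Ordinal lx)) => y /=.
split=> [<-|->]; first by rewrite drop_size_cat.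
by rewrite -{1}xs cat_take_drop.
Qed.

Lemma regularU (T : eqType) (L1 L2 : set (seq T)) :
  regular L1 -> regular L2 -> regular (L1 `|` L2).
Proof.
move=> [Q1 [f1 h1]] [Q2 [f2 h2]].
exists (Q1 * Q2)%type, (fun q => f1 q.1 `|` f2 q.2) => x.
have [q1 e1] := h1 x; have [q2 e2] := h2 x.
exists (q1, q2) => y; split=> /= -[];
  [move/e1|move/e2|move/e1|move/e2]; by [left|right].
Qed.

(** A left quotient of [L1 L2] by [x] is determined by the quotient of [L1] by
    [x] and the set of quotients of [L2] by those suffixes of [x] whose
    complementary prefix is in [L1]. *)
Lemma regular_cat (T : eqType) (L1 L2 : set (seq T)) :
  regular L1 -> regular L2 -> regular (lang_cat L1 L2).
Proof.
move=> [Q1 [f1 h1]] [Q2 [f2 h2]].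
exists (Q1 * {set Q2})%type,
  (fun q : Q1 * {set Q2} => lang_cat (f1 q.1) L2 `|`
    [set y | exists2 q2, q2 \in q.2 & f2 q2 y]).
move=> x; have [q1 e1] := h1 x.
exists (q1, [set q2 | `[< exists x1 x2, [/\ x = x1 ++ x2, L1 x1 &
   forall y, L2 (x2 ++ y) <-> f2 q2 y] >]])%SET => y; split=> /=.
  move=> [u Lu [v Lv /cat_eq_cat[[z [uE ->]]|[z [xE vE]]]]].
    by left; exists z; [apply/e1; rewrite -uE | exists v].
  right; have [q2 e2] := h2 z; exists q2; last by apply/e2; rewrite -vE.
  by rewrite inE; apply/asboolP; exists u, z.
case=> [[z /e1 L1z [v Lv <-]]|[q2]].
  by exists (x ++ z) => //; exists v => //; rewrite catA.
rewrite inE => /asboolP[x1 [x2 [-> Lx1 e2]]] /e2 L2y.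
by exists x1 => //; exists (x2 ++ y) => //; rewrite catA.
Qed.

Lemma lang_star0 (T : eqType) (L : set (seq T)) : lang_star L [::].
Proof. by exists [::]. Qed.

Lemma lang_star_cons (T : eqType) (L : set (seq T)) x y :
  L x -> lang_star L y -> lang_star L (x ++ y).
Proof.
move=> Lx [ws -> h]; exists (x :: ws) => // u.
by rewrite inE => /orP[/eqP ->|/h].
Qed.

Lemma lang_star_cat (T : eqType) (L : set (seq T)) x y :
  lang_star L x -> lang_star L y -> lang_star L (x ++ y).
Proof.
move=> [ws -> h] [ws' -> h']; exists (ws ++ ws'); first by rewrite flatten_cat.
by move=> u; rewrite mem_cat => /orP[/h|/h'].
Qed.

Lemma lang_star_split (T : eqType) (L : set (seq T)) x y :
  x != [::] -> lang_star L (x ++ y) ->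
  exists x1 x2 y1 y2, [/\ x = x1 ++ x2, y = y1 ++ y2, lang_star L x1,
    L (x2 ++ y1) & lang_star L y2].
Proof.
move=> x0 [ws e h]; elim: ws x x0 e h => [|u ws IH] x x0; first by case: x x0.
move=> /= e h; have Lu : L u by apply: h; rewrite mem_head.
have h' v : v \in ws -> L v by move=> vw; apply: h; rewrite inE vw orbT.
case: (cat_eq_cat e) => [[z [xE fE]]|[z [uE yE]]]; last first.
  exists [::], x, z, (flatten ws); rewrite -uE; split=> //; first by exists [::].
  by exists ws.
have [z0|z0] := eqVneq z [::].
  exists [::], x, [::], y; rewrite xE z0 !cats0; split=> //; first by exists [::].
  by exists ws => //; rewrite fE z0.
have [x1 [x2 [y1 [y2 [zE yE s1 l2 s2]]]]] := IH z z0 (esym fE) h'.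
exists (u ++ x1), x2, y1, y2; split=> //; first by rewrite xE zE catA.
exact: lang_star_cons.
Qed.

(** For nonempty [x], the quotient of the star by [x] is determined by the set of
    quotients of [L] by those suffixes of [x] whose complementary prefix is in
    the star; the empty word accounts for the additional value [None]. *)
Lemma regular_star (T : eqType) (L : set (seq T)) :
  regular L -> regular (lang_star L).
Proof.
move=> [Q [f h]].
exists (option {set Q}), (fun o : option {set Q} => if o is Some Z then
   [set y | exists2 q, q \in Z & lang_cat (f q) (lang_star L) y]
   else lang_star L) => x.
have [->|x0] := eqVneq x [::]; first by exists None.
exists (Some [set q | `[< exists x1 x2, [/\ x = x1 ++ x2, lang_star L x1 &
   forall y, L (x2 ++ y) <-> f q y] >]])%SET => y /=; split.
  move=> /(lang_star_split x0)[x1 [x2 [y1 [y2 [xE yE s1 l2 s2]]]]].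
  have [q e] := h x2; exists q.
    by rewrite inE; apply/asboolP; exists x1, x2.
  by exists y1; [apply/e | exists y2].
move=> [q]; rewrite inE => /asboolP[x1 [x2 [-> s1 e]]] [y1 /e l2 [y2 s2 <-]].
rewrite -catA; apply: lang_star_cat => //; rewrite catA.
exact: lang_star_cons.
Qed.

(** The class of sets whose image is spelled by a regular language contains the
    finite sets and is closed under the rational operations. *)
Lemma rational_regular (H : groupType) (phi : {multiplicative H -> word})
    (R : set H) : Rat H R ->
  exists2 L, regular L & (letters \o phi) @` R = reduce @` L.
Proof.
set F := [set R : set H |
  exists2 L, regular L & (letters \o phi) @` R = reduce @` L].
move=> RatR; apply: (RatR F); split; last first.
  move=> A /finite_seqP[s ->]; elim: s => [|x s [L rL e]].
    exists set0; first exact: regular0.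
    by rewrite image_set0; apply/seteqP; split=> z [].
  exists ([set letters (phi x)] `|` L); first exact: (regularU (regular1 _)).
  have -> : [set` x :: s] = [set x] `|` [set` s].
    by apply/seteqP; split=> y /=; rewrite inE => /predU1P.
  rewrite !image_setU e !image_set1 /=.
  by rewrite reduce_id // letters_reduced.
split=> [A B [L1 r1 e1] [L2 r2 e2]|A B [L1 r1 e1] [L2 r2 e2]|A [L rL e]].
- exists (L1 `|` L2); first exact: regularU.
  by rewrite !image_setU e1 e2.
- exists (lang_cat L1 L2); first exact: regular_cat.
  apply/seteqP; split=> [_ [_ [x Ax [y By <-]] <-]|_ [_ [x Lx [y Ly <-]] <-]].
    have [x' Lx' ex] : (reduce @` L1) (letters (phi x)) by rewrite -e1; exists x.
    have [y' Ly' ey] : (reduce @` L2) (letters (phi y)) by rewrite -e2; exists y.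
    exists (x' ++ y'); first by exists x' => //; exists y'.
    by rewrite /= gmulfM -reduce_catl -reduce_catr ex ey.
  have [x' Lx' ex] : ((letters \o phi) @` A) (reduce x) by rewrite e1; exists x.
  have [y' Ly' ey] : ((letters \o phi) @` B) (reduce y) by rewrite e2; exists y.
  exists (x' * y')%g; first by exists x' => //; exists y'.
  by rewrite /= gmulfM /= [letters (phi x')]ex [letters (phi y')]ey
    reduce_catl reduce_catr.
exists (lang_star L); first exact: regular_star.
apply/seteqP; split=> [_ [x sx <-]|_ [_ [ws -> h] <-]].
  apply: (sx [set x | (reduce @` lang_star L) (letters (phi x))]); split.
    split=> /=; first by exists [::]; [apply: lang_star0 | rewrite hom1].
    move=> y z [y' Ly' ey] [z' Lz' ez]; exists (y' ++ z').
      exact: lang_star_cat.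
    by rewrite gmulfM -reduce_catl -reduce_catr ey ez.
  move=> y Ay /=.
  have [y' Ly' ey] : (reduce @` L) (letters (phi y)) by rewrite -e; exists y.
  by exists y' => //; rewrite -[y']cats0; apply: lang_star_cons => //;
    apply: lang_star0.
elim: ws h => [|u ws IH] h /=.
  by exists 1%g; [move=> S [[]] | rewrite /= hom1].
have Lu : L u by apply: h; rewrite mem_head.
have [u' Au' eu] : ((letters \o phi) @` A) (reduce u) by rewrite e; exists u.
have [|v gv ev] := IH; first by move=> v vw; apply: h; rewrite inE vw orbT.
exists (u' * v)%g.
  move=> S [[S1 SM] AS]; apply: (SM); first exact: AS.
  exact: (gv S (conj (conj S1 SM) AS)).
by rewrite /= gmulfM /= [letters (phi u')]eu [letters (phi v)]ev
  reduce_catl reduce_catr.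
Qed.

(** * Pumping the blocks of a reduced word *)

Lemma reduce_blocks c n z s : reduce s = nseq n c ++ z ->
  exists Vs t, [/\ size Vs = n, all (fun v => reduce v == [:: c]) Vs,
    s = flatten Vs ++ t & reduce t = z].
Proof.
elim: n s => [|n IH] s /= e; first by exists [::], s.
have [s1 [s2 [-> e1 /IH[Vs [t [sV aV -> tz]]]]]] := @reduce_split s [:: c] _ e.
by exists (s1 :: Vs), t; rewrite /= sV e1 eqxx catA.
Qed.

Lemma reduce_flatten_blocks c Vs : all (fun v => reduce v == [:: c]) Vs ->
  reduce (flatten Vs) = nseq (size Vs) c.
Proof.
have cn n : reduce (nseq n c) = nseq n c.
  elim: n => //= n ->; case: n => //= n.
  by rewrite /cancelling eqxx /= eqxx.
elim: Vs => //= v Vs IH /andP[/eqP ve /IH IHe].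
by rewrite -reduce_catl -reduce_catr ve IHe -[_ ++ _]/(nseq (size Vs).+1 c) cn.
Qed.

Definition blocks (ns : seq nat) : seq letter :=
  flatten [seq la :: nseq n lb | n <- ns].

Lemma blocks_cons ns q :
  exists2 c : letter, c.2 & exists z, blocks ns ++ la :: q = c :: z.
Proof. by case: ns => [|n ns]; exists la => //; eexists. Qed.

(** Any spelling of [a b^N z] splits into a spelling of [a], [N] spellings of
    [b] and a spelling of [z].  If [N] is the number of left quotients, two of
    the [N + 1] cuts between these pieces define the same quotient, and the
    pieces between them may be repeated at will.  The repetition makes [n]
    exceed every element of [avoid]. *)
Lemma pump_block (L : set (seq letter)) (Q : finType) (f : Q -> set (seq letter))
    (hf : forall x, exists q, forall y, L (x ++ y) <-> f q y)
    (avoid : seq nat) (x s z : seq letter) :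
  L (x ++ s) -> reduce s = la :: nseq #|Q| lb ++ z ->
  exists n u t, [/\ n \notin avoid, reduce u = la :: nseq n lb, reduce t = z &
    L (x ++ u ++ t)].
Proof.
move=> Lxs /(@reduce_split s [:: la])[X [s' [sE eX]]].
move=> /reduce_blocks[Vs [t [sV aV s'E tz]]].
have /choice[st hst] : forall i : 'I_#|Q|.+1, exists q, forall y,
    L (x ++ X ++ flatten (take i Vs) ++ y) <-> f q y.
  move=> i; have [q e] := hf (x ++ X ++ flatten (take i Vs)).
  by exists q => y; rewrite -e !catA.
have /injectivePn[i [i' neq ist]] : ~~ injectiveb st.
  by apply/negP => /injectiveP/leq_card; rewrite card_ord ltnn.
wlog ii' : i i' neq ist / i < i' => [hw|].
  case: (ltngtP i i') => [/hw|/hw|/val_inj e]; first exact.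
    by rewrite eq_sym => /(_ neq (esym ist)).
  by rewrite e eqxx in neq.
have iQ : i' <= size Vs by rewrite sV -ltnS ltn_ord.
have tE : take i Vs ++ drop i (take i' Vs) = take i' Vs.
  by rewrite -[in LHS](take_takel Vs (ltnW ii')) cat_take_drop.
have eP y : L (x ++ X ++ flatten (take i Vs) ++ flatten (drop i (take i' Vs)) ++ y)
    <-> L (x ++ X ++ flatten (take i Vs) ++ y).
  rewrite [flatten _ ++ flatten _ ++ _]catA -flatten_cat tE.
  by split=> [/hst|/hst]; rewrite ?ist => h; apply/hst; rewrite ?ist.
have [m mP] : exists m, \max_(a <- avoid) a < m by eexists.
pose Us := take i Vs ++ flatten (nseq m (drop i (take i' Vs))) ++ drop i' Vs.
exists (size Us), (X ++ flatten Us), t; split=> //.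
- apply/negP => nav.
  have : size Us <= \max_(a <- avoid) a.
    exact: (@leq_bigmax_seq _ avoid xpredT id _ nav isT).
  rewrite /Us !size_cat size_flatten /shape map_nseq sumn_nseq size_drop.
  rewrite !size_takel // ?(ltnW (leq_trans ii' iQ)) // => /leP; nia.
- rewrite -reduce_catl -reduce_catr eX (@reduce_flatten_blocks lb).
    by rewrite reduce_id // positive_reduced //= all_nseq orbT.
  have sub (I : seq (seq letter)) : {subset I <= Vs} ->
      all (fun v => reduce v == [:: lb]) I.
    by move=> IV; apply/allP => v /IV; apply: (allP aV).
  rewrite /Us !all_cat; apply/and3P; split.
  + by apply: sub => v /mem_take.
  + apply: sub => v /flattenP[B]; rewrite mem_nseq => /andP[_ /eqP ->].
    by move=> /mem_drop/mem_take.
  + by apply: sub => v /mem_drop.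
rewrite /Us flatten_cat [flatten (_ ++ _)]flatten_cat -!catA.
elim: (m) => [|k IH] /=.
  rewrite -eP [flatten _ ++ flatten _ ++ _]catA -flatten_cat.
  rewrite tE.
  by rewrite [flatten _ ++ flatten _ ++ _]catA -flatten_cat cat_take_drop -s'E -sE.
by rewrite flatten_cat -!catA eP.
Qed.

(** The blocks are pumped from left to right.  Each exponent obtained joins the
    list to avoid, which makes the exponents distinct. *)
Lemma pump_blocks (L : set (seq letter)) (Q : finType) (f : Q -> set (seq letter))
    (hf : forall x, exists q, forall y, L (x ++ y) <-> f q y)
    (r : nat) (avoid : seq nat) (x s q : seq letter) :
  L (x ++ s) -> reduce s = blocks (nseq r #|Q|) ++ la :: q ->
  exists ns s', [/\ size ns = r, uniq ns, {in ns, forall n, n \notin avoid},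
    L (x ++ s') & reduce s' = blocks ns ++ la :: q].
Proof.
elim: r avoid x s => [|r IH] avoid x s Ls; first by exists [::], s.
rewrite /blocks /= -catA => /(pump_block hf avoid Ls)[n [u [t [nav eu et]]]].
rewrite catA => /(IH (n :: avoid)) /(_ et)[ns [s' [sns uns ins Ls' es']]].
exists (n :: ns), (u ++ s'); split; rewrite /= ?sns //.
- by rewrite uns andbT; apply/negP => /ins; rewrite mem_head.
- by move=> k; rewrite inE => /predU1P[->|/ins] //; rewrite inE negb_or => /andP[].
- by rewrite catA.
rewrite -catA -[RHS]/((la :: nseq n lb) ++ _).
have [d d2 [z zE]] := blocks_cons ns q.
rewrite zE in es' *; apply: reduce_cat_positive eu es' => //.
by rewrite /= all_nseq orbT.
Qed.

(** * Balance of the pumped words *)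

Lemma runs_nseq st n z :
  runs st (nseq n lb ++ z) = runs (omap (addn n) st) z.
Proof.
by elim: n st => [|n IH] [i|] //=; rewrite IH /= ?addnS.
Qed.

Lemma runs_blocks ns q :
  runs None (blocks ns ++ la :: q) = ns ++ runs (Some 0) q.
Proof.
have some i : runs (Some i) (blocks ns ++ la :: q) = i :: ns ++ runs (Some 0) q.
  elim: ns i => [|n ns IH] i //=.
  by rewrite -catA runs_nseq /= IH addn0.
case: ns some => [|n ns] //= some.
by have := some 0; rewrite /= => -[].
Qed.

Lemma runs_negative st s : all (fun c : letter => ~~ c.2) s -> runs st s = [::].
Proof.
elim: s st => // -[i []] s IH st //= ss.
by rewrite !xpair_eqE !andbF IH.
Qed.

Lemma winv_positive s : all snd s -> all (fun c : letter => ~~ c.2) (winv s).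
Proof.
by rewrite /winv all_rev all_map; apply: sub_all => c /= ->.
Qed.

Lemma blocks_positive ns : all snd (blocks ns).
Proof. by elim: ns => //= n ns IH; rewrite all_cat IH all_nseq orbT. Qed.

(** A scan of the word outputs [ns] and then the outputs due to [q], while a scan
    of its inverse outputs nothing within the inverses of the positive letters
    in front of [q]. *)
Lemma balance_blocks i ns q n : uniq ns -> n \in ns ->
    n \notin runs (Some 0) q ++ runs None (winv q) ->
  balance (nseq i lb ++ blocks ns ++ la :: q) n = 1%R.
Proof.
move=> uns nns; rewrite mem_cat negb_or => /andP[nq nq'].
rewrite /balance /nruns runs_nseq runs_blocks count_cat count_uniq_mem // nns.
rewrite (count_memPn nq) -[la :: q]cat1s !catA winv_cat runs_cat count_cat.
rewrite (count_memPn nq') runs_negative //.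
apply: winv_positive; rewrite !all_cat blocks_positive all_nseq /= orbT //.
Qed.

(** * A substitution without cancellation *)

Lemma reduced_catE d x y : x != [::] -> y != [::] ->
  reduced (x ++ y) =
    [&& reduced x, ~~ cancelling (last d x) (head d y) & reduced y].
Proof. by case: x y => [|c x] [|e y] //= _ _; rewrite cat_path. Qed.

(** The default letter [lb] has index [1], so the conditions on the first and
    last letters also force [h] to be nonempty. *)
Definition core (h : seq letter) : Prop :=
  [/\ (head lb h).1 = 0, (last lb h).1 = 0 & reduced (h ++ h)].

Lemma core_neq0 h : core h -> h != [::].
Proof. by case: h => // -[]. Qed.

Lemma head_winv d s : s != [::] -> head d (winv s) = linv (last d s).
Proof.
by case/lastP: s => // s c _; rewrite /winv map_rcons rev_rcons last_rcons.
Qed.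

Lemma last_winv d s : s != [::] -> last d (winv s) = linv (head d s).
Proof. by case: s => // c s _; rewrite /winv map_cons rev_cons last_rcons. Qed.

Lemma core_winv h : core h -> core (winv h).
Proof.
move=> ch; have h0 := core_neq0 ch; case: ch => hd lst red.
by split; rewrite ?head_winv ?last_winv // -winv_cat winv_reduced.
Qed.

Lemma reduced_nseq_core c n h z : c.1 = 1 -> core h -> reduced (h ++ z) ->
  reduced (nseq n c ++ h ++ z).
Proof.
move=> c1 [hd _ _] hz; elim: n => //= n IH; case: n IH => [_|n IH] /=.
  case: h hd hz => // d h /= d0 ->.
  by rewrite /cancelling c1 d0.
by rewrite [path _ _ _]IH /cancelling !eqxx.
Qed.

Lemma reduced_core_cat h z : core h -> reduced z -> (head lb z).1 = 1 ->
  reduced (h ++ z).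
Proof.
move=> ch rz z1; have h0 := core_neq0 ch; have [_ lst /cat_sorted2[hr _]] := ch.
have [->|z0] := eqVneq z [::]; first by rewrite cats0.
by rewrite (reduced_catE lb) // rz hr andbT /cancelling lst z1.
Qed.

Definition core_of (h : seq letter) (x : letter) : seq letter :=
  if x.2 then h else winv h.

(** The image of a letter under the substitution of [b^i h b^-i] for the [i]-th
    variable. *)
Definition substitute (h : seq letter) (x : letter) : seq letter :=
  nseq x.1 lb ++ core_of h x ++ nseq x.1 (linv lb).

Lemma winv_nseq n c : winv (nseq n c) = nseq n (linv c).
Proof. by rewrite /winv map_nseq rev_nseq. Qed.

Lemma reduce_cancel x y z : reduce (x ++ winv y ++ y ++ z) = reduce (x ++ z).
Proof.
rewrite -reduce_catr [winv y ++ _]catA -[reduce (_ ++ z)]reduce_catl.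
by rewrite reduce_winv reduce_catr.
Qed.

Lemma core_of_core h x : core h -> core (core_of h x).
Proof. by rewrite /core_of; case: ifP => // _; apply: core_winv. Qed.

Lemma substitute_reduced h x : core h -> reduced (substitute h x).
Proof.
move=> /(core_of_core x) ch.
have nr : reduced (nseq x.1 (linv lb)).
  by rewrite -winv_nseq winv_reduced // positive_reduced // all_nseq orbT.
apply: reduced_nseq_core => //; apply: reduced_core_cat => //.
by case: (x.1).
Qed.

(** Between consecutive copies of [h] and its inverse there remains a power of
    [b], which cannot cancel against the outer letters of [h].  When the power
    is trivial, both letters of the word have the same index, hence the same
    sign as the word is reduced, and two equal cores meet without
    cancellation. *)
Lemma reduce_substitute h x s : core h -> reduced (x :: s) ->
  exists q, reduce (flatten (map (substitute h) (x :: s))) =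
            nseq x.1 lb ++ core_of h x ++ q.
Proof.
move=> ch; have chE y : core (core_of h y) by apply: core_of_core.
elim: s x => [|y s IH] x xs.
  exists (nseq x.1 (linv lb)); rewrite /= cats0 reduce_id //.
  exact: substitute_reduced.
have /andP[nxy ys] : ~~ cancelling x y && reduced (y :: s) by [].
have [q e] := IH y ys.
set k := core_of h y in e; have ck : core k by apply: chE.
have rkq : reduced (k ++ q).
  have := reduce_reduced (flatten (map (substitute h) (y :: s))).
  by rewrite e => /cat_sorted2[].
have sub_cons t : flatten (map (substitute h) (x :: t)) =
    nseq x.1 lb ++ core_of h x ++ winv (nseq x.1 lb) ++ flatten (map (substitute h) t).
  by rewrite /= -!catA winv_nseq.
rewrite sub_cons; move: (flatten (map (substitute h) (y :: s))) e => rest e.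
rewrite !catA -reduce_catr e -!catA.
have finish m : reduced (core_of h x ++ m ++ k ++ q) ->
    exists q', reduce (nseq x.1 lb ++ core_of h x ++ m ++ k ++ q) =
               nseq x.1 lb ++ core_of h x ++ q'.
  by move=> rm; exists (m ++ k ++ q); rewrite reduce_id // reduced_nseq_core.
case: (ltngtP x.1 y.1) => [lt|lt|eq1].
- rewrite -(subnKC (ltnW lt)) nseqD -catA.
  rewrite [X in reduce X]catA reduce_cancel -catA; apply: finish.
  apply: reduced_core_cat => //; first exact: reduced_nseq_core.
  by rewrite -subn_gt0 in lt; case: (y.1 - x.1) lt.
- rewrite -{2}(subnKC (ltnW lt)) nseqD winv_cat -catA.
  rewrite [X in reduce X]catA [X in reduce X]catA reduce_cancel -!catA.
  rewrite winv_nseq; apply: finish.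
  apply: reduced_core_cat => //; first exact: reduced_nseq_core.
  by rewrite -subn_gt0 in lt; case: (x.1 - y.1) lt.
rewrite eq1 [X in reduce X]catA reduce_cancel -!catA -eq1.
apply: (finish [::]) => /=.
have e2 : x.2 = y.2.
  by apply/eqP; move: nxy; rewrite /cancelling eq1 eqxx /= negbK.
have kE : core_of h x = k by rewrite /k /core_of e2.
rewrite kE; have [_ _ rkk] := ck; have k0 := core_neq0 ck.
have kq0 : k ++ q != [::] by case: (k) k0.
rewrite (reduced_catE lb) // rkq andbT.
move: rkk; rewrite (reduced_catE lb) // => /and3P[-> + _] /=.
by case: (k) k0.
Qed.

Lemma eval_word_substitute (h : seq letter) (w : word) (g : nat -> word) :
    core h -> (forall i, letters (g i) = reduce (substitute h (i, true))) ->
  letters (eval_word w g) = reduce (flatten (map (substitute h) w)).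
Proof.
move=> ch ge; rewrite /eval_word; elim: (letters w) => [|x s IH].
  by rewrite big_nil.
rewrite big_cons /= -[RHS]reduce_catr -IH.
set u := (if _ then _ else _); set v := \big[_/_]_(_ <- _) _.
rewrite -[LHS]/(reduce (u ++ v)) -[RHS]reduce_catl; congr (reduce (_ ++ _)).
have {}ge i : letters (g i) = substitute h (i, true).
  by rewrite ge reduce_id // substitute_reduced.
have -> : substitute h x = letters u; last first.
  by rewrite reduce_id // letters_reduced.
rewrite /u; case: x {u v IH} => i []; first by rewrite -ge.
rewrite -[RHS]/(winv (g i)) ge /substitute /core_of /= !winv_cat !winv_nseq.
by rewrite linvK catA.
Qed.

(** * Verbal sets of free products *)

Theorem corollary5p13 (C D H : groupType)
    (iC : {multiplicative C -> H}) (iD : {multiplicative D -> H})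
    (free_product_H : is_free_product iC iD)
    (fgC : finitely_generated C) (fgD : finitely_generated D)
    (infC : infinite_set (abelianization C))
    (infD : infinite_set (abelianization D))
    (w : word) (proper_w : proper_word w) :
  ~ Rat H (verbal_set w H).
Proof.
move=> RatH.
pose wa : word := @Word [:: la] isT; pose wb : word := @Word [:: lb] isT.
have [chiC chiCM [c0 c01]] := infinite_abelianization_character fgC infC.
have [chiD chiDM [d0 d01]] := infinite_abelianization_character fgD infD.
have [f fE] := hom_of_character wa chiCM; have [g gE] := hom_of_character wb chiDM.
have [phi [phiC phiD _]] := free_product_H _ f g.
have phia : letters (phi (iC c0)) = [:: la].
  by have /= -> := phiC c0; rewrite fE c01.
have phib : letters (phi (iD d0)) = [:: lb].
  by have /= -> := phiD d0; rewrite gE d01.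
have [L [Q [F hF]] eL] := rational_regular phi RatH.
have [k k1 kw] := proper_word_modulus proper_w.
case wE : (letters w) (proper_word_neq0 proper_w) => [|x s] // _.
(* one more than the number of exceptions that [balance_eval] allows *)
pose r := (6 * size w).+1.
pose h0 := blocks (nseq r #|Q|) ++ [:: la].
have h0pos : all snd h0 by rewrite all_cat blocks_positive.
have ch0 : core h0.
  split; [by [] | by rewrite last_cat |].
  by apply: positive_reduced; rewrite all_cat h0pos.
(* the orientation makes the first factor of the value [h0], not its inverse *)
pose h := core_of h0 x.
have ch : core h by rewrite /h /core_of; case: ifP => // _; apply: core_winv.
have hx : core_of h x = h0.
  by rewrite /h /core_of; case: (x.2); rewrite ?winvK.
have letter2 u : all (fun c : letter => c.1 < 2) u ->
    all (fun c : letter => c.1 < 2) (winv u).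
  by rewrite /winv all_rev all_map.
have h2 : all (fun c : letter => c.1 < 2) h.
  have h02 : all (fun c : letter => c.1 < 2) h0.
    rewrite all_cat andbT /blocks; elim: (nseq _ _) => //= n ns IH.
    by rewrite all_cat IH all_nseq orbT.
  by rewrite /h /core_of; case: ifP => // _; apply: letter2.
have /choice[t tE] : forall i : nat, exists y,
    letters (phi y) = reduce (substitute h (i, true)).
  move=> i; apply: (hom_image_letters phia phib).
  by rewrite /substitute !all_cat h2 !all_nseq /= orbT.
have vE : letters (phi (eval_word w t)) = reduce (flatten (map (substitute h) w)).
  by rewrite hom_eval_word; apply: eval_word_substitute.
have [q qE] : exists q, letters (phi (eval_word w t)) =
    nseq x.1 lb ++ blocks (nseq r #|Q|) ++ la :: q.
  have := letters_reduced w; rewrite vE wE => /(reduce_substitute ch)[q ->].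
  by exists q; rewrite hx -catA.
have [W LW WE] : (reduce @` L) (letters (phi (eval_word w t))).
  by rewrite -eL; exists (eval_word w t) => //; exists t.
have [X [W' [WX eX eW']]] := reduce_split (etrans WE qE).
rewrite WX in LW.
(* what scans of [q] and of its inverse contribute to the counts is avoided *)
have [ns [V [sns uns nsq LV eV]]] :=
  pump_blocks hF (runs (Some 0) q ++ runs None (winv q)) LW eW'.
have [y [u _ <-] yV] : ((letters \o phi) @` verbal_set w H) (reduce (X ++ V)).
  by rewrite eL; exists (X ++ V).
have yE : letters (phi (eval_word w u)) = nseq x.1 lb ++ blocks ns ++ la :: q.
  rewrite -[LHS]/((letters \o phi) _) yV; have [d d2 [z zE]] := blocks_cons ns q.
  rewrite zE in eV *; apply: reduce_cat_positive eX eV => //.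
  by rewrite all_nseq orbT.
have [E sE eE] := balance_eval w (phi \o u).
have /hasP[n nns nE] : has (predC (mem E)) ns.
  rewrite -[has _ _]negbK has_predC negbK; apply/negP => /allP nsE.
  by have := leq_trans (uniq_leq_size uns nsE) sE; rewrite sns ltnn.
have := kw (fun i => balance (phi (u i)) n).
rewrite -eE // -hom_eval_word yE balance_blocks //; last exact: nsq.
by rewrite dvdz1 /= => /eqP kk; rewrite kk in k1.
Qed.
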